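(* There exists a Laakso space $\mathfrak{L}$, namely the one constructed as the Gromov--Hausdorff limit of the finite metric spaces $X_0\subset X_1\subset X_2\subset\dots$ described in the context, that does not belong to the class $\mathcal{LCJ}$; that is, there exists a map $\gamma\colon[a,b]\to\mathfrak{L}$ with $\operatorname{LV}_\gamma<\infty$ and $\operatorname{V}_\gamma=\infty$.
   Context: Let $a<b$ be real numbers and let $\mathcal{X}=(\mathcal{X},\rho)$ be a metric space. For a map $\gamma\colon[a,b]\to\mathcal{X}$ (no continuity assumed) set $$\operatorname{V}_\gamma=\sup\sum_{i=1}^N\rho(\gamma(t_{i-1}),\gamma(t_i)),$$ the supremum being over all finite tuples $a=t_0<t_1<\dots<t_N=b$. For $f\colon\mathcal{X}\to\mathbb{R}$ let $L_f=\sup_{x_1\neq x_2}|f(x_1)-f(x_2)|/\rho(x_1,x_2)$ be its global Lipschitz constant, and set $$\operatorname{LV}_\gamma=\sup\{\operatorname{V}_{f\circ\gamma} \mid f\colon\mathcal{X}\to\mathbb{R},\ L_f\le 1\}.$$ The class $\mathcal{LCJ}$ consists of the metric spaces $\mathcal{X}$ such that every map $\gamma\colon[a,b]\to\mathcal{X}$ with $\operatorname{LV}_\gamma<\infty$ satisfies $\operatorname{V}_\gamma<\infty$ (one says that on $\mathcal{X}$ Lipschitz functions catch jumps). The Laakso space. Let $G_0$ be the graph with two vertices $0,1$ joined by a single edge (identified with the unit interval), and let $X_0=\{0,1\}$ with the metric of the unit interval. Let $G_1$ be the graph obtained by splitting the unit interval into four intervals of equal length and replacing the two middle ones with a rhombus: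 $G_1$ has vertices $0,B,P,Q,C,1$ and the six edges $\{0,B\}$, $\{B,P\}$, $\{B,Q\}$, $\{P,C\}$, $\{Q,C\}$, $\{C,1\}$. For $i\ge1$ the graph $G_{i+1}$ is obtained from $G_i$ by replacing each edge of $G_i$ with a copy of $G_1$ (the vertices $0$ and $1$ of the copy being identified with the two endpoints of the edge). Let $X_i$ be the set of vertices of $G_i$ equipped with $4^{-i}$ times the natural graph metric of $G_i$. Naturally $X_i\subset X_{i+1}$ isometrically. The Laakso space $\mathfrak{L}$ is the Gromov--Hausdorff limit of the sequence $\{X_i\}_i$ (equivalently, the completion of $\bigcup_i X_i$). *)

(* Defs.v *)
From HB Require Import structures.
From mathcomp Require Import all_boot all_order all_algebra.
From mathcomp Require Import all_classical all_reals all_analysis.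

Set Implicit Arguments.
Unset Strict Implicit.
Unset Printing Implicit Defensive.

Import Order.TTheory GRing.Theory Num.Theory.
Import numFieldNormedType.Exports.

Local Open Scope classical_set_scope.
Local Open Scope ring_scope.

Section Variation.
Context {R : realType}.

Definition metric_variation (T : metricType R) (a b : R) (g : R -> T) : \bar R :=
  ereal_sup [set (\sum_(0 <= i < size s)
                    mdist (g (nth b (a :: s) i)) (g (nth b s i)))%:E
            | s in itv_partition a b].

(* On the real line this is the total variation of MathComp-Analysis. *)
Lemma metric_variationE (a b : R) (g : R -> R) :
  @metric_variation R^o a b g = total_variation a b g.
Proof.
rewrite /metric_variation /total_variation /variations image_comp.
by [].
Qed.

Definition lip_const (T : metricType R) (f : T -> R) : \bar R :=
  ereal_sup [set (`|f p.1 - f p.2| / mdist p.1 p.2)%:E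
            | p in [set p : T * T | p.1 <> p.2]].

Definition lip_variation (T : metricType R) (a b : R) (g : R -> T) : \bar R :=
  ereal_sup [set total_variation a b (f \o g)
            | f in [set f : T -> R | (lip_const f <= 1)%E]].

(* A map [a, b] -> T is represented by a function on R, of which only the
   values on [a, b] are used by [metric_variation] and [lip_variation]. *)
Definition LCJ (a b : R) (T : metricType R) : Prop :=
  forall g : R -> T, (lip_variation a b g < +oo)%E ->
    (metric_variation a b g < +oo)%E.

End Variation.

Section Limits.
Context {R : realType}.

Definition isometry (S T : metricType R) (f : S -> T) : Prop :=
  forall x y, mdist (f x) (f y) = mdist x y.

Definition hausdorff_dist (T : metricType R) (A B : set T) : \bar R :=
  ereal_inf [set r%:E | r in [set r : R | [/\ 0 <= r,
    forall x, A x -> exists2 y, B y & mdist x y <= r &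
    forall y, B y -> exists2 x, A x & mdist x y <= r]]].

Definition gh_dist (S T : metricType R) : \bar R :=
  ereal_inf [set d | exists (Z : metricType R) (f : S -> Z) (g : T -> Z),
    [/\ isometry f, isometry g & d = hausdorff_dist (range f) (range g)]].

Definition is_gh_limit (X : nat -> metricType R) (L : metricType R) : Prop :=
  compact [set: L] /\ gh_dist (X i) L @[i --> \oo] --> 0%E.

(* [L] is the completion of the union of X 0 c X 1 c ..., the inclusions being
   the maps [j]. *)
Definition is_union_completion (X : nat -> metricType R)
    (j : forall i, X i -> X i.+1) (L : metricType R) : Prop :=
  (forall F : set_system L, ProperFilter F -> cauchy F -> exists x : L, F --> x) /\
  exists h : forall i, X i -> L,
    [/\ forall i, isometry (h i),
        forall i x, h i.+1 (j i x) = h i x &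
        closure (\bigcup_i range (h i)) = [set: L]].

End Limits.

(* Finite multigraphs.  Edges carry an orientation, used only to say which
   endpoint of an edge is glued to which endpoint of a copy of [G1]. *)
Record graph := Graph {
  vert : finType;
  edge : finType;
  src : edge -> vert;
  tgt : edge -> vert }.

Definition adj (G : graph) : rel (vert G) := [rel x y | [exists e : edge G,
  ((src e == x) && (tgt e == y)) || ((src e == y) && (tgt e == x))]].

Definition graph_dist (R : realType) (G : graph) (x y : vert G) : R :=
  inf [set (size p)%:R | p in
        [set p : seq (vert G) | path (@adj G) x p && (last x p == y)]].

Definition G0 : graph := @Graph bool unit (fun=> false) (fun=> true).

Inductive inner := B | P | Q | C.
Inductive edge1 := e0B | eBP | eBQ | ePC | eQC | eC1.

Definition inner_code v := match v with B => 0 | P => 1 | Q => 2 | C => 3 end%N.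
Definition inner_decode n := match n with
  | 0 => Some B | 1 => Some P | 2 => Some Q | 3 => Some C | _ => None end%N.
Lemma inner_codeK : pcancel inner_code inner_decode. Proof. by case. Qed.
HB.instance Definition _ := Countable.copy inner (pcan_type inner_codeK).
Lemma inner_enumP : Finite.axiom [:: B; P; Q; C]. Proof. by case. Qed.
HB.instance Definition _ := fintype.isFinite.Build inner inner_enumP.

Definition edge1_code e := match e with
  | e0B => 0 | eBP => 1 | eBQ => 2 | ePC => 3 | eQC => 4 | eC1 => 5 end%N.
Definition edge1_decode n := match n with
  | 0 => Some e0B | 1 => Some eBP | 2 => Some eBQ
  | 3 => Some ePC | 4 => Some eQC | 5 => Some eC1 | _ => None end%N.
Lemma edge1_codeK : pcancel edge1_code edge1_decode. Proof. by case. Qed.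
HB.instance Definition _ := Countable.copy edge1 (pcan_type edge1_codeK).
Lemma edge1_enumP : Finite.axiom [:: e0B; eBP; eBQ; ePC; eQC; eC1].
Proof. by case. Qed.
HB.instance Definition _ := fintype.isFinite.Build edge1 edge1_enumP.

(* [inl false] and [inl true] are the end vertices 0 and 1. *)
Definition G1 : graph := @Graph (bool + inner)%type edge1
  (fun e => match e with
    | e0B => inl false | eBP => inr B | eBQ => inr B
    | ePC => inr P | eQC => inr Q | eC1 => inr C end)
  (fun e => match e with
    | e0B => inr B | eBP => inr P | eBQ => inr Q
    | ePC => inr C | eQC => inr C | eC1 => inl true end).

Definition glue (G : graph) (e : edge G) (v : vert G1) :
    vert G + edge G * inner :=
  match v with
  | inl false => inl (src e)
  | inl true => inl (tgt e)
  | inr w => inr (e, w)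
  end.

Definition replace (G : graph) : graph :=
  @Graph (vert G + edge G * inner)%type (edge G * edge1)%type
    (fun p => glue p.1 (@src G1 p.2)) (fun p => glue p.1 (@tgt G1 p.2)).

(* [laakso_graph 1] is [G1], up to the name of the unique edge of [G0]. *)
Fixpoint laakso_graph (i : nat) : graph :=
  if i is i'.+1 then replace (laakso_graph i') else G0.

Lemma adj_sym G : symmetric (@adj G).
Proof.
by move=> x y; apply/existsP/existsP => -[e he]; exists e; rewrite orbC.
Qed.

Lemma adj_edge G (e : edge G) : adj (src e) (tgt e).
Proof. by apply/existsP; exists e; rewrite !eqxx. Qed.

Definition connected_graph G := forall x y : vert G, connect (@adj G) x y.

Lemma replace_connected G : connected_graph G -> connected_graph (replace G).
Proof.
move=> cG.
have sC x y : connect (@adj (replace G)) x y -> connect (@adj (replace G)) y x.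
  by rewrite (sym_connect_sym (@adj_sym _)).
have E e (k : edge1) : connect (@adj (replace G))
    (glue e (@src G1 k)) (glue e (@tgt G1 k)).
  by apply: connect1; exact: (@adj_edge (replace G) (e, k)).
have toB e w : connect (@adj (replace G)) (glue e (inr B)) (glue e (inr w)).
  case: w; [exact: connect0|exact: (E e eBP)|exact: (E e eBQ)|].
  exact: connect_trans (E e eBP) (E e ePC).
have toS e w : connect (@adj (replace G)) (inl (src e)) (inr (e, w)).
  exact: connect_trans (E e e0B) (toB e w).
have ST e : connect (@adj (replace G)) (inl (src e)) (inl (tgt e)).
  exact: connect_trans (toS e C) (E e eC1).
have LL x y : connect (@adj (replace G)) (inl x) (inl y).
  have /connectP[p + ->] := cG x y.
  elim: p x => [x _|z p IH x /= /andP[/existsP[e he] hp]]; first exact: connect0.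
  apply: connect_trans (IH z hp).
  by case/orP: he => /andP[/eqP <- /eqP <-]; [|apply: sC]; exact: ST.
have toL x : exists y, connect (@adj (replace G)) (inl y) x.
  by case: x => [y|[e w]]; [exists y; exact: connect0|exists (src e); exact: toS].
move=> x y; have [[x' hx] [y' hy]] := (toL x, toL y).
exact: connect_trans (sC _ _ hx) (connect_trans (LL x' y') hy).
Qed.

Lemma laakso_graph_connected i : connected_graph (laakso_graph i).
Proof.
elim: i => [|i IH]; last exact: replace_connected.
have h : connect (@adj G0) false true.
  by apply: connect1; exact: (@adj_edge G0 tt).
by move=> [] []; rewrite ?connect0 // (sym_connect_sym (@adj_sym _)).
Qed.

Section GraphDist.
Variables (R : realType) (G : graph).
Local Notation d := (@graph_dist R G).

Lemma graph_dist_le x p : path (@adj G) x p -> d x (last x p) <= (size p)%:R.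
Proof.
move=> hp; apply: ge_inf; first by exists 0 => _ [q _ <-]; rewrite ler0n.
by exists p => //=; rewrite hp eqxx.
Qed.

Hypothesis cG : connected_graph G.

Lemma graph_dist_attained x y :
  exists p, [/\ path (@adj G) x p, last x p = y & d x y = (size p)%:R].
Proof.
pose W n := `[< exists p, [/\ path (@adj G) x p, last x p = y & size p = n] >].
have exW : exists n, W n.
  have /connectP[p hp hl] := cG x y.
  by exists (size p); apply/asboolP; exists p.
case: (ex_minnP exW) => n /asboolP[p [hp hl hs]] hmin.
exists p; split => //; apply/eqP; rewrite eq_le; apply/andP; split.
  by rewrite -hl; exact: graph_dist_le.
apply: lb_le_inf; first by exists (size p)%:R, p => //=; rewrite hp hl eqxx.
move=> _ [q /= /andP[hq /eqP hlq] <-]; rewrite ler_nat hs.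
by apply: hmin; apply/asboolP; exists q.
Qed.

Lemma graph_distxx x : d x x = 0.
Proof.
apply/eqP; rewrite eq_le; apply/andP; split; first exact: (@graph_dist_le x [::]).
by have [p [_ _ ->]] := graph_dist_attained x x; rewrite ler0n.
Qed.

Lemma graph_dist_eq0 x y : d x y = 0 -> x = y.
Proof.
have [p [_ <- ->]] := graph_dist_attained x y.
by move/eqP; rewrite pnatr_eq0 size_eq0 => /eqP ->.
Qed.

Lemma graph_dist_sym x y : d x y = d y x.
Proof.
have le u v : d u v <= d v u.
  have [p [hp <- ->]] := graph_dist_attained v u.
  have hr : path (@adj G) (last v p) (rev (belast v p)).
    by rewrite (eq_path (e' := fun z => (@adj G)^~ z)) ?rev_path// => ? ?;
       exact: adj_sym.
  have hl : last (last v p) (rev (belast v p)) = v.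
    by case: p {hp hr} => //= z p; rewrite rev_cons last_rcons.
  by have := graph_dist_le hr; rewrite hl size_rev size_belast.
by apply/eqP; rewrite eq_le !le.
Qed.

Lemma graph_dist_triangle y x z : d x z <= d x y + d y z.
Proof.
have [p [hp hl ->]] := graph_dist_attained x y.
have [q [hq <- ->]] := graph_dist_attained y z.
rewrite -natrD -size_cat -{1}hl -last_cat; apply: graph_dist_le.
by rewrite cat_path hp hl.
Qed.

End GraphDist.

Section LaaksoVertices.
Variable R : realType.

Definition laakso_vert (i : nat) : Type := vert (laakso_graph i).
HB.instance Definition _ i := Finite.copy (laakso_vert i) (vert (laakso_graph i)).

Definition laakso_dist (i : nat) (x y : laakso_vert i) : R :=
  4 ^- i * @graph_dist R (laakso_graph i) x y.

Lemma laakso_distxx i (x : laakso_vert i) : laakso_dist x x = 0.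
Proof.
by rewrite /laakso_dist graph_distxx ?mulr0//; exact: laakso_graph_connected.
Qed.

Lemma laakso_dist_eq0 i (x y : laakso_vert i) : laakso_dist x y = 0 -> x = y.
Proof.
move/eqP; rewrite mulf_eq0 invr_eq0 expf_eq0 pnatr_eq0 andbF /= => /eqP.
exact/graph_dist_eq0/laakso_graph_connected.
Qed.

Lemma laakso_dist_sym i (x y : laakso_vert i) :
  laakso_dist x y = laakso_dist y x.
Proof.
by congr (_ * _); exact/graph_dist_sym/laakso_graph_connected.
Qed.

Lemma laakso_dist_triangle i (y x z : laakso_vert i) :
  laakso_dist x z <= laakso_dist x y + laakso_dist y z.
Proof.
rewrite -mulrDr ler_pM2l ?invr_gt0 ?exprn_gt0//.
exact/graph_dist_triangle/laakso_graph_connected.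
Qed.

HB.instance Definition _ i := isMetric.Build R (laakso_vert i)
  (@laakso_distxx i) (@laakso_dist_eq0 i) (@laakso_dist_sym i)
  (@laakso_dist_triangle i).

End LaaksoVertices.

Definition laakso_X (R : realType) (i : nat) : metricType R := laakso_vert i.

Definition laakso_incl (R : realType) (i : nat) (x : laakso_X R i) :
  laakso_X R i.+1 := inl x.

(* Main.v *)
(* Given an edge of level i, with length l = 4^-i, call P and Q the two middle
   points of the rhombus replacing it, at distance l / 2. Refine the edge through
   K further levels and walk along the geodesics that pass on the same side in
   all rhombi of the same level, jumping from P to Q and back in every rhombus
   met: on average the length of such a walk is at least K l. For a 1-Lipschitz
   f, the parallelogram inequality bounds |f P - f Q|^2 / l by the increase, when
   each edge is replaced with a rhombus, of the energy (the sum of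
   |f(tgt) - f(src)|^2 / length over the edges of a geodesic, averaged over the
   geodesics). This energy is at most l, so by Cauchy-Schwarz the average length
   of the image of the walk under f is O(sqrt K l). Taking K = n^2 and a copy
   small enough that the 4^K repetitions of the walks have total weight n^-2 gives
   loops at the vertex 0 of length at least 1, whose images under all 1-Lipschitz
   f have length at most 4 / n. Running through such loops for n = 8, 16, 32, ...
   in finite time gives the path.

   The space itself is the inverse limit of the X_i along retractions
   X_(i+1) -> X_i that move points by at most 4^-i / 2. *)
From HB Require Import structures.
Require Import Defs.
From mathcomp Require Import all_boot all_order all_algebra.
From mathcomp Require Import all_classical all_reals all_analysis.
From mathcomp Require Import finmap zify ring lra.

Set Implicit Arguments.
Unset Strict Implicit.
Unset Printing Implicit Defensive.

Import Order.TTheory GRing.Theory Num.Theory.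
Import numFieldNormedType.Exports.
Local Open Scope classical_set_scope.
Local Open Scope ring_scope.

(** * Powers of 1/4, ultrafilters on finite partitions, and compatible sequences *)

Lemma cvg_expVn4 (R : realType) : (4 : R) ^- n @[n --> \oo] --> (0 : R).
Proof.
have -> : (fun n => (4 : R) ^- n) = geometric 1 4^-1.
  by apply/funext => n /=; rewrite mul1r exprVn.
by apply: cvg_geometric; rewrite ger0_norm ?invf_lt1 ?ltr1n// invr_ge0.
Qed.

Lemma exprV4S (R : realType) n : (4 : R) ^- n.+1 = 4 ^- n / 4.
Proof. by rewrite exprSr invfM mulrC. Qed.

Lemma exprV4_gt0 (R : realType) n : 0 < (4 : R) ^- n.
Proof. by rewrite invr_gt0 exprn_gt0. Qed.

(** Otherwise the ultrafilter contains the complement of every fibre, hence their finite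
    intersection, which is empty. *)
Lemma ultra_finite (T : Type) (U : choiceType) (F : set_system T) (f : T -> U) :
  UltraFilter F -> finite_set [set: U] -> exists v, F [set t | f t = v].
Proof.
move=> FU finU; apply: contrapT => /forallNP nF.
have /filter_ex[t] : F (\bigcap_(v in [set` fset_set [set: U]])
    ~` [set t | f t = v]).
  by apply: filter_bigI => v _; have [/nF|] := in_ultra_setVsetC [set t | f t = v] FU.
by move/(_ (f t)) => /=; rewrite in_fset_set// in_setT => /(_ isT).
Qed.

Lemma expV4_lt (R : realType) (e : R) : 0 < e -> exists n, 4 ^- n < e.
Proof.
move=> e0; have /cvgrPdist_lt /(_ _ e0) [N _ /(_ N (leqnn N))] := @cvg_expVn4 R.
by rewrite /= sub0r normrN ger0_norm ?invr_ge0 ?exprn_ge0//; exists N.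
Qed.

(* The sequence through [v : X i] going down by [p] and up by [j]; the recursion
   shifts [X] to avoid casts between the types [X n]. *)
Fixpoint thread_from i : forall (X : nat -> Type) (j : forall n, X n -> X n.+1)
    (p : forall n, X n.+1 -> X n), X i -> forall n, X n :=
  match i with
  | 0 => fun X j _ v n => nat_rect X v j n
  | i'.+1 => fun X j p v =>
    let x := @thread_from i' (fun n => X n.+1) (fun n => j n.+1)
      (fun n => p n.+1) v in
    fun n => match n with 0 => p 0%N (x 0%N) | n'.+1 => x n' end
  end.

Arguments thread_from : simpl never.

Section ThreadFrom.
Variables (X : nat -> Type) (j : forall n, X n -> X n.+1).
Variable (p : forall n, X n.+1 -> X n).

Lemma thread_from_at i (v : X i) : thread_from j p v i = v.
Proof. elim: i X j p v => // i IH X' j' p' v.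
exact: (IH (fun n => X' n.+1) (fun n => j' n.+1) (fun n => p' n.+1)). Qed.

Lemma thread_from_up i (v : X i) n : (i <= n)%N ->
  thread_from j p v n.+1 = j (thread_from j p v n).
Proof.
elim: i X j p v n => //= i IH X' j' p' v [//|n] h.
exact: (IH (fun n => X' n.+1) (fun n => j' n.+1) (fun n => p' n.+1)).
Qed.

Hypothesis jK : forall n, cancel (@j n) (@p n).

Lemma thread_from_proj i (v : X i) n :
  p (thread_from j p v n.+1) = thread_from j p v n.
Proof.
elim: i X j p jK v n => [|i IH] X' j' p' jK' v n; first exact: jK'.
case: n => [//|n].
by apply: (IH _ (fun n => j' n.+1) (fun n => p' n.+1)) => m; exact: jK'.
Qed.

End ThreadFrom.

(** * Inverse limits of finite metric spaces along retractions *)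

Section InverseLimit.
Context {R : realType} (X : nat -> metricType R).
Variables (j : forall n, X n -> X n.+1) (p : forall n, X n.+1 -> X n).
Hypothesis j_isometry : forall n, Defs.isometry (@j n).
Hypothesis jK : forall n, cancel (@j n) (@p n).
Hypothesis jp_close : forall n (z : X n.+1), mdist (j (p z)) z <= 4 ^- n / 2 :> R.

Definition thread := {x : forall n, X n | forall n, p (x n.+1) = x n}.

Definition thread_pt (x : thread) n : X n := sval x n.

Definition level_dist (x y : thread) n : R := mdist (thread_pt x n) (thread_pt y n).

(** Both points of level [n.+1] lie within [4 ^- n / 2] of the [j]-images of their projections. *)
Lemma level_dist_step x y n :
  `|level_dist x y n.+1 - level_dist x y n| <= 4 ^- n.
Proof.
rewrite /level_dist /thread_pt; case: x y => [x hx] [y hy] /=.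
rewrite -(hx n) -(hy n) -(@j_isometry n (p _)).
set u := x n.+1; set v := y n.+1.
have h1 := jp_close u; have h2 := jp_close v.
have := metric_triangle (j (p u)) u (j (p v)).
have := metric_triangle u v (j (p v)).
have := metric_triangle u (j (p u)) v.
have := metric_triangle (j (p u)) (j (p v)) v.
rewrite [mdist u (j (p u))]metric_sym [mdist v (j (p v))]metric_sym.
by move=> *; rewrite ler_norml; lra.
Qed.

(** The correction drops by [3/2 * 4 ^- n] at each step, more than the distance can grow.
    Convergence follows by monotonicity. *)
Lemma level_dist_ubound_nonincreasing x y :
  nonincreasing_seq (fun n => level_dist x y n + 2 * 4 ^- n).
Proof.
apply/nonincreasing_seqP => n; have := level_dist_step x y n.
rewrite exprV4S ler_norml => /andP[_ h].
have := exprV4_gt0 R n; lra.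
Qed.

Lemma cvg_level_dist x y : cvgn (level_dist x y).
Proof.
have -> : level_dist x y =
    (fun n => level_dist x y n + 2 * 4 ^- n) - (fun n => 2 * 4 ^- n).
  by apply/funext => n; rewrite /= [RHS]addrK.
apply: is_cvgB; last by apply: is_cvgMr; apply/cvgP; exact: cvg_expVn4.
apply: nonincreasing_is_cvgn; first exact: level_dist_ubound_nonincreasing.
by exists 0 => _ [n _ <-]; rewrite addr_ge0 ?mdist_ge0// mulr_ge0.
Qed.

Definition thread_dist x y : R := limn (level_dist x y).

Lemma thread_dist_le x y n : thread_dist x y <= level_dist x y n + 2 * 4 ^- n.
Proof.
have cu : cvgn (fun n => level_dist x y n + 2 * 4 ^- n).
  apply: nonincreasing_is_cvgn; first exact: level_dist_ubound_nonincreasing.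
  by exists 0 => _ [m _ <-]; rewrite addr_ge0 ?mdist_ge0// mulr_ge0.
apply: le_trans (nonincreasing_cvgn_ge (level_dist_ubound_nonincreasing x y) cu n).
apply: ler_lim => //; first exact: cvg_level_dist.
by apply: nearW => m; rewrite lerDl mulr_ge0.
Qed.

Lemma thread_dist_eventually x y N c :
  (forall n, (N <= n)%N -> level_dist x y n = c) -> thread_dist x y = c.
Proof.
move=> h; apply/cvg_lim => //; apply: cvg_near_cst.
by exists N => // n /= /h.
Qed.

Lemma thread_distxx x : thread_dist x x = 0.
Proof. by apply: (@thread_dist_eventually _ _ 0) => n _; exact: mdistxx. Qed.

Lemma thread_dist_sym x y : thread_dist x y = thread_dist y x.
Proof.
by congr (limn _); apply/funext => n; rewrite /level_dist metric_sym.
Qed.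

Lemma thread_dist_ge0 x y : 0 <= thread_dist x y.
Proof.
apply: limr_ge; first exact: cvg_level_dist.
by apply: nearW => n; exact: mdist_ge0.
Qed.

Lemma thread_dist_triangle y x z :
  thread_dist x z <= thread_dist x y + thread_dist y z.
Proof.
rewrite -limD; try exact: cvg_level_dist.
apply: ler_lim; first exact: cvg_level_dist.
  by apply: is_cvgD; exact: cvg_level_dist.
by apply: nearW => n; exact: metric_triangle.
Qed.

HB.instance Definition _ := gen_eqMixin thread.
HB.instance Definition _ := gen_choiceMixin thread.

(** Distinct threads may be at distance 0, for instance when they approach one point from both ends
    of a nested sequence of edges. Hence the quotient. *)
Definition thread_eqv (x y : thread) : bool := thread_dist x y == 0.

Lemma thread_eqv_refl : reflexive thread_eqv.
Proof. by move=> x; apply/eqP/thread_distxx. Qed.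

Lemma thread_eqv_sym : symmetric thread_eqv.
Proof. by move=> x y; rewrite /thread_eqv thread_dist_sym. Qed.

Lemma thread_eqv_trans : transitive thread_eqv.
Proof.
move=> y x z /eqP xy /eqP yz; rewrite /thread_eqv eq_le thread_dist_ge0 andbT.
by rewrite (le_trans (thread_dist_triangle y x z))// xy yz addr0.
Qed.

Canonical thread_equiv :=
  EquivRel thread_eqv thread_eqv_refl thread_eqv_sym thread_eqv_trans.

Definition inverse_limit := {eq_quot thread_equiv}%qT.
HB.instance Definition _ := Choice.on inverse_limit.

Definition to_limit (x : thread) : inverse_limit := (\pi_({eq_quot thread_equiv}) x)%qT.
Definition of_limit (x : inverse_limit) : thread := repr x.

Lemma of_limitK x : to_limit (of_limit x) = x.
Proof. exact: reprK. Qed.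

Lemma to_limit_eq x y : thread_dist x y = 0 -> to_limit x = to_limit y.
Proof. by move=> xy; apply/eqmodP/eqP. Qed.

Lemma of_to_limit x : thread_dist (of_limit (to_limit x)) x = 0.
Proof.
apply/eqP; suff : thread_equiv (of_limit (to_limit x)) x by [].
by apply/eqmodP; exact: of_limitK.
Qed.

Definition limit_dist (x y : inverse_limit) : R :=
  thread_dist (of_limit x) (of_limit y).

Lemma limit_distxx x : limit_dist x x = 0.
Proof. exact: thread_distxx. Qed.

Lemma limit_dist_eq0 x y : limit_dist x y = 0 -> x = y.
Proof. by move/to_limit_eq; rewrite !of_limitK. Qed.

Lemma limit_dist_sym x y : limit_dist x y = limit_dist y x.
Proof. exact: thread_dist_sym. Qed.

Lemma limit_dist_triangle y x z :
  limit_dist x z <= limit_dist x y + limit_dist y z.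
Proof. exact: thread_dist_triangle. Qed.

HB.instance Definition _ := isMetric.Build R inverse_limit
  limit_distxx limit_dist_eq0 limit_dist_sym limit_dist_triangle.

Lemma mdist_to_limit x y : mdist (to_limit x) (to_limit y) = thread_dist x y.
Proof.
apply/eqP; rewrite eq_le; apply/andP; split.
  apply: le_trans (thread_dist_triangle x _ _) _; rewrite of_to_limit add0r.
  apply: le_trans (thread_dist_triangle y _ _) _.
  by rewrite [X in _ + X]thread_dist_sym of_to_limit addr0.
apply: le_trans (thread_dist_triangle (of_limit (to_limit x)) _ _) _.
rewrite thread_dist_sym of_to_limit add0r.
apply: le_trans (thread_dist_triangle (of_limit (to_limit y)) _ _) _.
by rewrite of_to_limit addr0.
Qed.

Lemma limit_dist_le (x y : thread) n : thread_pt x n = thread_pt y n ->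
  mdist (to_limit x) (to_limit y) <= 2 * 4 ^- n.
Proof.
move=> xy; rewrite mdist_to_limit (le_trans (thread_dist_le x y n))//.
by rewrite /level_dist xy mdistxx add0r.
Qed.

Hypothesis finX : forall n, finite_set [set: X n].

(** At each level the ultrafilter selects one point. These points form a thread, because any two of
    the selected sets meet, and this thread is the limit. *)
Lemma inverse_limit_ultra (F : set_system inverse_limit) :
  UltraFilter F -> exists x : inverse_limit, F --> x.
Proof.
move=> FU.
have pick n := ultra_finite (fun x => thread_pt (of_limit x) n) FU (@finX n).
pose v n := projT1 (cid (pick n)).
have Fv n : F [set x | thread_pt (of_limit x) n = v n].
  exact: (projT2 (cid (pick n))).
have vP n : p (v n.+1) = v n.
  have [x [/= <- <-]] := filter_ex (filterI (Fv n.+1) (Fv n)).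
  exact: (svalP (of_limit x)).
exists (to_limit (exist _ v vP)).
apply/metricType_numDomainType.fcvgrPdist_lt => e e0.
have e20 : 0 < e / 2 by rewrite divr_gt0.
have [n] := expV4_lt e20; rewrite ltr_pdivlMr// mulrC => ne.
apply: filterS (Fv n) => x /= xn; apply: le_lt_trans ne.
by rewrite -[x in mdist _ x]of_limitK; exact: limit_dist_le.
Qed.

Lemma inverse_limit_compact : compact [set: inverse_limit].
Proof.
rewrite compact_ultra => F FU _.
by have [x Fx] := inverse_limit_ultra FU; exists x.
Qed.

(** A finer ultrafilter converges, and a Cauchy filter shares the limit of any finer filter. *)
Lemma inverse_limit_complete (F : set_system inverse_limit) :
  ProperFilter F -> cauchy F -> exists x : inverse_limit, F --> x.
Proof.
move=> FF cF; have [G [GU FG]] := ultraFilterLemma FF.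
have [x Gx] := inverse_limit_ultra GU; exists x.
apply/metricType_numDomainType.fcvgrPdist_lt => e e0.
have e30 : 0 < e / 3 by rewrite divr_gt0.
have [y Fy] := (cauchyP F).1 cF _ e30.
have [z [xz yz]] := filter_ex (filterI (Gx _ (nbhsx_ballx x _ e30)) (FG _ Fy)).
apply: filterS Fy => t yt.
have : ball x (e / 3 + e / 3 + e / 3) t.
  by apply: ball_triangle yt; apply: ball_triangle xz (ball_sym yz).
by rewrite ballEmdist /=; congr (_ < _); field.
Qed.

Definition thread_of i (v : X i) : thread :=
  exist _ (thread_from j p v) (thread_from_proj jK v).

Definition limit_incl i (v : X i) : inverse_limit := to_limit (thread_of v).

(** From level [i] on, the two threads only move up by the isometries [j], so their level distances
    are constant. *)
Lemma limit_incl_isometry i : Defs.isometry (@limit_incl i).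
Proof.
move=> v w; rewrite mdist_to_limit; apply: (@thread_dist_eventually _ _ i) => n.
rewrite /level_dist /thread_pt /=.
elim: n => [|n IH]; rewrite leq_eqVlt => /predU1P[<-|]//;
  try by rewrite !thread_from_at.
rewrite ltnS => in_.
by rewrite !thread_from_up ?j_isometry ?IH.
Qed.

Lemma limit_incl_comp i (v : X i) : limit_incl (j v) = limit_incl v.
Proof.
apply: to_limit_eq; apply: (@thread_dist_eventually _ _ i.+1) => n.
rewrite /level_dist /thread_pt /= => in_.
suff -> : thread_from j p (j v) n = thread_from j p v n by rewrite mdistxx.
elim: n in_ => // n IH; rewrite leq_eqVlt => /predU1P[[= <-]|in_].
  by rewrite thread_from_at thread_from_up// thread_from_at.
by rewrite !thread_from_up ?IH// ltnW.
Qed.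

Lemma limit_incl_dense (x : inverse_limit) n :
  exists v : X n, mdist (limit_incl v) x <= 2 * 4 ^- n.
Proof.
exists (thread_pt (of_limit x) n).
rewrite -[x in mdist _ x]of_limitK; apply: limit_dist_le.
by rewrite /thread_pt /= thread_from_at.
Qed.

Lemma closure_limit_incl :
  closure (\bigcup_i range (@limit_incl i)) = [set: inverse_limit].
Proof.
apply/seteqP; split => // x _ B /nbhs_ballP[e /= e0 xB].
have e20 : 0 < e / 2 by rewrite divr_gt0.
have [n] := expV4_lt e20; rewrite ltr_pdivlMr// mulrC => ne.
have [v vx] := limit_incl_dense x n; exists (limit_incl v); split.
  by exists n => //; exists v.
by apply: xB; rewrite ballEmdist /= metric_sym (le_lt_trans vx).
Qed.

Lemma inverse_limit_is_completion :
  is_union_completion j (inverse_limit : metricType R).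
Proof.
split; first exact: inverse_limit_complete.
by exists limit_incl; split;
  [exact: limit_incl_isometry|exact: limit_incl_comp|exact: closure_limit_incl].
Qed.

Lemma inverse_limit_is_gh_limit : is_gh_limit X (inverse_limit : metricType R).
Proof.
split; first exact: inverse_limit_compact.
apply: (@squeeze_cvge _ _ _ _ (cst 0%E) _ (fun n => (2 * 4 ^- n)%:E)).
- apply: nearW => n; apply/andP; split.
    apply: le_ereal_inf_tmp => _ [Z [f [g [_ _ ->]]]].
    by apply: le_ereal_inf_tmp => _ [r [r0 _ _] <-]; rewrite lee_fin.
  (* The limit itself serves as the common space containing both [X n] and the limit. *)
  apply: le_trans (_ : hausdorff_dist (range (@limit_incl n)) (range id) <= _)%E.
    apply: ereal_inf_lbound; exists (inverse_limit : metricType R), (@limit_incl n), id.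
    by split => //; exact: limit_incl_isometry.
  apply: ereal_inf_lbound; exists (2 * 4 ^- n) => //; split.
  + by rewrite mulr_ge0.
  + by move=> x _; exists x; [exists x|rewrite mdistxx mulr_ge0].
  + move=> y _; have [v vy] := limit_incl_dense y n.
    by exists (limit_incl v) => //; exists v.
- exact: cvg_cst.
- apply: cvg_EFin; first exact: nearW.
  rewrite -[X in _ --> X](mulr0 (2 : R)).
  by apply: cvgMr; exact: cvg_expVn4.
Qed.

End InverseLimit.

(** * Graph distances under replacement of edges *)

Section GraphFacts.
Variable R : realType.
Local Notation d G := (@graph_dist R G).

Lemma graph_dist_adj (G : graph) (x y : vert G) : adj x y -> d G x y <= 1.
Proof. by move=> xy; apply: (@graph_dist_le R G x [:: y]); rewrite /= xy. Qed.

(** This is the source of lower bounds on distances: it suffices to exhibit one suitable [phi]. *)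
Lemma graph_dist_lipschitz (G : graph) (phi : vert G -> R) x y :
  connected_graph G ->
  (forall e : edge G, `|phi (src e) - phi (tgt e)| <= 1) ->
  phi y - phi x <= d G x y.
Proof.
move=> cG lip; have [q [hq <- ->]] := graph_dist_attained R cG x y.
elim: q x hq => [|z q IH] x /=; first by rewrite subrr.
case/andP => /existsP[e he] /IH; rewrite -natr1.
suff : phi z - phi x <= 1 by lra.
have := lip e; rewrite ler_norml => /andP[].
by case/orP: he => /andP[/eqP <- /eqP <-]; lra.
Qed.

Lemma graph_dist_ge2 (G : graph) (x y : vert G) : connected_graph G ->
  x != y -> ~~ adj x y -> 2 <= d G x y.
Proof.
move=> cG xy nxy; have [q [hq hl ->]] := graph_dist_attained R cG x y.
case: q hq hl => [_ /= xy'|z [|z' q]]; first by rewrite xy' eqxx in xy.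
  by rewrite /= andbT => xz zy; rewrite -zy xz in nxy.
by rewrite ler_nat.
Qed.

Lemma glue_adj (G : graph) (e : edge G) (k : edge1) :
  @adj (replace G) (Defs.glue e (@src G1 k)) (Defs.glue e (@tgt G1 k)).
Proof. exact: (@adj_edge (replace G) (e, k)). Qed.

Lemma graph_dist_replace_src_tgt (G : graph) (e : edge G) :
  connected_graph G -> d (replace G) (inl (src e)) (inl (tgt e)) <= 4.
Proof.
move=> cG.
apply: (@graph_dist_le R (replace G) (inl (src e))
  [:: inr (e, B); inr (e, P); inr (e, C); inl (tgt e)]) => /=.
by rewrite (glue_adj e e0B) (glue_adj e eBP) (glue_adj e ePC) (glue_adj e eC1).
Qed.

Lemma graph_dist_replace (G : graph) (x y : vert G) : connected_graph G ->
  d (replace G) (inl x) (inl y) = 4 * d G x y.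
Proof.
move=> cG; have cG' := replace_connected cG.
apply/eqP; rewrite eq_le; apply/andP; split.
  have [q [hq <- ->]] := graph_dist_attained R cG x y.
  elim: q x hq => [|z q IH] x /=; first by rewrite graph_distxx// mulr0.
  case/andP => /existsP[e he] /IH; rewrite -natr1.
  have := graph_dist_triangle R cG' (inl z) (inl x) (inl (last z q)).
  suff : d (replace G) (inl x) (inl z) <= 4 by lra.
  case/orP: he => /andP[/eqP <- /eqP <-]; last rewrite graph_dist_sym//;
  exact: graph_dist_replace_src_tgt.
(* [phi] is the expected distance from [inl x]: an inner vertex is reached through one of the two
   ends of its edge, and [h] is its distance from the source inside the copy of [G1]. Only its
   Lipschitz property has to be checked. *)
pose h (w : inner) : R := match w with B => 1 | P => 2 | Q => 2 | C => 3 end.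
pose phi (z : vert (replace G)) : R := match z with
  | inl z => 4 * d G x z
  | inr (e, w) => Num.min (4 * d G x (src e) + h w) (4 * d G x (tgt e) + (4 - h w))
  end.
suff : phi (inl y) - phi (inl x) <= d (replace G) (inl x) (inl y).
  by rewrite /phi graph_distxx// mulr0 subr0.
apply: graph_dist_lipschitz => // -[e k].
have h1 := graph_dist_adj (adj_edge e).
have h2 := graph_dist_triangle R cG (src e) x (tgt e).
have h3 := graph_dist_triangle R cG (tgt e) x (src e).
rewrite (graph_dist_sym R cG (tgt e)) in h3.
rewrite ler_norml; apply/andP; rewrite /phi.
by case: k => /=; split; rewrite /Order.min; do ?case: ltrP => ?; lra.
Qed.

Lemma graph_dist_replace_PQ (G : graph) (e : edge G) : connected_graph G ->
  2 <= d (replace G) (inr (e, P)) (inr (e, Q)).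
Proof.
move=> cG; apply: graph_dist_ge2; first exact: replace_connected.
  by apply/eqP => -[].
by apply/negP => /existsP[[e0 k]]; case: k => /orP[] /andP[/eqP h1 /eqP h2];
  try discriminate h1; discriminate h2.
Qed.

End GraphFacts.

(** * The Laakso space as an inverse limit *)

Section LaaksoSpace.
Variable R : realType.

(** [B] and [C] go to the nearer end of the edge; [P] and [Q] are equally far from both, and the
    target is an arbitrary choice. No vertex moves by more than two edges of length [4 ^- i.+1]. *)
Definition laakso_proj i (z : laakso_X R i.+1) : laakso_X R i :=
  match z with
  | inl v => v
  | inr (e, w) => if w is B then src e else tgt e
  end.

Lemma mdist_laaksoE i (x y : laakso_X R i) :
  mdist x y = 4 ^- i * graph_dist R x y.
Proof. by []. Qed.

Lemma laakso_incl_isometry i : Defs.isometry (@laakso_incl R i).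
Proof.
move=> x y; rewrite !mdist_laaksoE graph_dist_replace; last first.
  exact: laakso_graph_connected.
by rewrite exprV4S mulrA divfK.
Qed.

Lemma laakso_proj_close i (z : laakso_X R i.+1) :
  mdist (laakso_incl (laakso_proj z)) z <= 4 ^- i / 2.
Proof.
have cG := @laakso_graph_connected i.+1.
rewrite mdist_laaksoE exprV4S.
have -> : (4 : R) ^- i / 2 = 4 ^- i / 4 * 2 by field.
rewrite ler_pM2l ?divr_gt0 ?exprV4_gt0// graph_dist_sym//.
have two x (q : seq (vert (laakso_graph i.+1))) : path (@adj _) x q ->
    (size q <= 2)%N -> graph_dist R x (last x q) <= 2.
  by move=> /(graph_dist_le R) /le_trans h sq; apply: h; rewrite ler_nat.
case: z => [v|[e w]] /=; first by rewrite graph_distxx.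
have adjE (k : edge1) := glue_adj e k.
case: w.
- apply: (two (inr (e, B)) [:: inl (src e)]) => //=.
  by rewrite adj_sym (adjE e0B).
- apply: (two (inr (e, P)) [:: inr (e, C); inl (tgt e)]) => //=.
  by rewrite (adjE ePC) (adjE eC1).
- apply: (two (inr (e, Q)) [:: inr (e, C); inl (tgt e)]) => //=.
  by rewrite (adjE eQC) (adjE eC1).
- apply: (two (inr (e, C)) [:: inl (tgt e)]) => //=.
  by rewrite (adjE eC1).
Qed.

Lemma laakso_space_exists : exists L : metricType R,
  is_gh_limit (laakso_X R) L /\ is_union_completion (@laakso_incl R) L.
Proof.
have inclK i : cancel (@laakso_incl R i) (@laakso_proj i) by [].
have finX i : finite_set [set: laakso_X R i].
  exact: (@finite_finset (vert (laakso_graph i))).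
exists (inverse_limit laakso_incl_isometry laakso_proj_close); split.
  exact: inverse_limit_is_gh_limit.
exact: inverse_limit_is_completion.
Qed.

End LaaksoSpace.

(** * Sums over consecutive points of a finite sequence *)

Section Chain.
Context {R : realType} {T : Type}.
Implicit Types (q : T -> T -> R) (s : seq T) (y : T).

(** The end point [y] is kept outside [s], which makes the sum additive under concatenation. *)
Fixpoint chain q s y : R :=
  if s is x :: s' then q x (head y s') + chain q s' y else 0.

Lemma chain_cat q s s' y :
  chain q (s ++ s') y = chain q s (head y s') + chain q s' y.
Proof.
elim: s => [|x s IH] /=; first by rewrite add0r.
by rewrite IH addrA; case: s {IH}.
Qed.

Lemma chain_sum q s y :
  chain q s y = \sum_(0 <= k < size s) q (nth y s k) (nth y s k.+1).
Proof.
elim: s => [|x s IH] /=; first by rewrite big_nil.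
by rewrite big_nat_recl//= IH nth0.
Qed.

End Chain.

(** * Walks with jumps: their length and the length of their Lipschitz images *)

Section Walks.
Context {R : realType} (L : metricType R) (h : forall i, laakso_X R i -> L).
Hypothesis h_isometry : forall i, Defs.isometry (@h i).
Hypothesis h_incl : forall i (x : laakso_X R i), h (laakso_incl x) = h x.

Definition pt i (x : laakso_vert i) : L := h (x : laakso_X R i).

Definition edge_src i (e : edge (laakso_graph i)) : L := @pt i (src e).
Definition edge_tgt i (e : edge (laakso_graph i)) : L := @pt i (tgt e).
Definition sub_edge i (e : edge (laakso_graph i)) (k : edge1) :
  edge (laakso_graph i.+1) := (e, k).
Definition inner_pt i (e : edge (laakso_graph i)) (w : inner) : L :=
  @pt i.+1 (inr (e, w)).

Lemma pt_inl i (x : laakso_vert i) : @pt i.+1 (inl x) = pt x.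
Proof. exact: h_incl. Qed.

Lemma edge_src_sub i (e : edge (laakso_graph i)) k :
  edge_src (sub_edge e k) = match k with
    | e0B => edge_src e | eBP => inner_pt e B | eBQ => inner_pt e B
    | ePC => inner_pt e P | eQC => inner_pt e Q | eC1 => inner_pt e C end.
Proof. by case: k => //; exact: pt_inl. Qed.

Lemma edge_tgt_sub i (e : edge (laakso_graph i)) k :
  edge_tgt (sub_edge e k) = match k with
    | e0B => inner_pt e B | eBP => inner_pt e P | eBQ => inner_pt e Q
    | ePC => inner_pt e C | eQC => inner_pt e C | eC1 => edge_tgt e end.
Proof. by case: k => //; exact: pt_inl. Qed.

Lemma mdist_edge i (e : edge (laakso_graph i)) :
  mdist (edge_src e) (edge_tgt e) <= 4 ^- i.
Proof.
rewrite h_isometry mdist_laaksoE ler_piMr//.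
exact/graph_dist_adj/adj_edge.
Qed.

Lemma mdist_inner_PQ i (e : edge (laakso_graph i)) :
  4 ^- i / 2 <= mdist (inner_pt e P) (inner_pt e Q).
Proof.
rewrite h_isometry mdist_laaksoE exprV4S.
have -> : (4 : R) ^- i / 2 = 4 ^- i / 4 * 2 by field.
rewrite ler_pM2l ?divr_gt0 ?exprV4_gt0//.
exact/graph_dist_replace_PQ/laakso_graph_connected.
Qed.

(* The walk omits its end point [edge_tgt e], so that walks along consecutive
   edges concatenate without repetition. *)
Fixpoint walk (ks : seq bool) : forall i, edge (laakso_graph i) -> seq L :=
  match ks with
  | [::] => fun i e => [:: edge_src e]
  | s :: ks' => fun i e =>
      walk ks' (sub_edge e e0B) ++
      walk ks' (sub_edge e (if s then eBP else eBQ)) ++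
      [:: inner_pt e (if s then P else Q); inner_pt e (if s then Q else P)] ++
      walk ks' (sub_edge e (if s then ePC else eQC)) ++
      walk ks' (sub_edge e eC1)
  end.

Lemma head_walk ks i (e : edge (laakso_graph i)) y s :
  head y (walk ks e ++ s) = edge_src e.
Proof.
elim: ks i e s => [//|k ks IH] i e s /=.
by rewrite -catA IH edge_src_sub.
Qed.

Section Variation.
Variable q : L -> L -> R.
Hypothesis q_sym : forall x y, q x y = q y x.

(** Here [q] stands for [mdist] in the lower bound and for [|f x - f y|] in the upper bound; the
    recursion over levels is the same for both. *)
Definition walk_var ks i (e : edge (laakso_graph i)) : R :=
  chain q (walk ks e) (edge_tgt e).

Lemma walk_var_nil i (e : edge (laakso_graph i)) :
  walk_var [::] e = q (edge_src e) (edge_tgt e).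
Proof. by rewrite /walk_var /= addr0. Qed.

(** The two jumps arise because, after [P] and [Q] have been listed, the next part of the walk
    starts at [P] again (with the roles exchanged if [s] is false). *)
Lemma walk_var_cons s ks i (e : edge (laakso_graph i)) :
  walk_var (s :: ks) e =
    walk_var ks (sub_edge e e0B) +
    walk_var ks (sub_edge e (if s then eBP else eBQ)) +
    walk_var ks (sub_edge e (if s then ePC else eQC)) +
    walk_var ks (sub_edge e eC1) + 2 * q (inner_pt e P) (inner_pt e Q).
Proof.
have headw ks' j (e' : edge (laakso_graph j)) y :
    head y (walk ks' e') = edge_src e' by rewrite -[walk _ _]cats0 head_walk.
rewrite /walk_var /= !chain_cat /= !chain_cat !head_walk !headw.
rewrite !edge_src_sub !edge_tgt_sub.
by case: s; rewrite ?edge_src_sub ?edge_tgt_sub (q_sym (inner_pt e Q)); lra.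
Qed.

(* Each letter is listed twice, so there are [4 ^ K] words of length [K]:
   this compensates the contraction factor [4 ^- K] of the edges. *)
Fixpoint words (K : nat) : seq (seq bool) :=
  if K is K'.+1 then
    let ws := words K' in
    let t := map (cons true) ws in let f := map (cons false) ws in
    t ++ t ++ f ++ f
  else [:: [::]].

Lemma size_words K : size (words K) = (4 ^ K)%N.
Proof. by elim: K => //= K IH; rewrite !size_cat !size_map IH expnS; lia. Qed.

Definition total_var K i (e : edge (laakso_graph i)) : R :=
  \sum_(ks <- words K) walk_var ks e.

Lemma total_var0 i (e : edge (laakso_graph i)) :
  total_var 0 e = q (edge_src e) (edge_tgt e).
Proof. by rewrite /total_var /= big_seq1 walk_var_nil. Qed.

(** [e0B] and [eC1] lie on the walks of all four blocks of [words K.+1], the sides of the rhombus on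
    those of two blocks. Each of the [4 ^ K.+1] words adds two jumps. *)
Lemma total_varS K i (e : edge (laakso_graph i)) :
  total_var K.+1 e =
    4 * total_var K (sub_edge e e0B) +
    2 * (total_var K (sub_edge e eBP) + total_var K (sub_edge e eBQ) +
         total_var K (sub_edge e ePC) + total_var K (sub_edge e eQC)) +
    4 * total_var K (sub_edge e eC1) +
    4 ^+ K * (8 * q (inner_pt e P) (inner_pt e Q)).
Proof.
have sumc (c : R) : \sum_(ks <- words K) c = 4 ^+ K * c.
  by rewrite big_const_seq count_predT size_words iter_addr_0 -[LHS]mulr_natl natrX.
have var_cons s : \sum_(ks <- words K) walk_var (s :: ks) e =
    total_var K (sub_edge e e0B) +
    total_var K (sub_edge e (if s then eBP else eBQ)) +
    total_var K (sub_edge e (if s then ePC else eQC)) +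
    total_var K (sub_edge e eC1) + 4 ^+ K * (2 * q (inner_pt e P) (inner_pt e Q)).
  rewrite -sumc -!big_split; apply: eq_bigr => ks _; exact: walk_var_cons.
by rewrite [LHS]/total_var /= !big_cat /= !big_map !var_cons; lra.
Qed.

End Variation.

(** The sub-edges have total weight 16 and a quarter of the length, so they reproduce [K] times
    [4 ^- i] per word. The two jumps per word, each of length at least [4 ^- i / 2], add one more
    [4 ^- i]. *)
Lemma total_mdist_ge K i (e : edge (laakso_graph i)) :
  4 ^+ K * (K%:R * 4 ^- i) <= total_var mdist K e.
Proof.
elim: K i e => [|K IH] i e; first by rewrite mul0r mulr0 total_var0 mdist_ge0.
rewrite (total_varS (@metric_sym _ L)).
have hk k := IH _ (sub_edge e k).
have {hk} := (hk e0B, hk eBP, hk eBQ, hk ePC, hk eQC, hk eC1).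
rewrite exprV4S exprS -(natr1 K) => -[[[[[h1 h2] h3] h4] h5] h6].
have : 4 ^+ K * (8 * (4 ^- i / 2)) <=
    4 ^+ K * (8 * mdist (inner_pt e P) (inner_pt e Q)).
  by rewrite ler_wpM2l ?exprn_ge0// ler_wpM2l// mdist_inner_PQ.
move: (4 ^+ K) (4 ^- i) h1 h2 h3 h4 h5 h6 => N l *. lra.
Qed.

Section Lipschitz.
Variable f : L -> R.
Hypothesis f_lip : forall x y, `|f x - f y| <= mdist x y.
Let q x y := `|f x - f y|.
Let q_sym x y : q x y = q y x. Proof. exact: distrC. Qed.

(* Since [2 x <= d l + x^2 / (d l)], it suffices that the increase of energy be at
   least [2 (xP - xQ)^2]; [d] is the parameter of the linearized Cauchy-Schwarz. *)
Lemma rhombus_energy (d l x0 xB xP xQ xC x1 : R) : 0 < d -> 0 < l ->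
  2 * `|xP - xQ| <= d * l + (2 * d * l)^-1 *
    (4 * ((xB - x0) ^+ 2 + (x1 - xC) ^+ 2) +
     2 * ((xP - xB) ^+ 2 + (xQ - xB) ^+ 2 + (xC - xP) ^+ 2 + (xC - xQ) ^+ 2) -
     (x1 - x0) ^+ 2).
Proof.
move=> d0 l0; set E := (X in _ + (_)^-1 * X).
have hE : 2 * (xP - xQ) ^+ 2 <= E.
  rewrite -subr_ge0.
  (* By the parallelogram identity at [xB] and at [xC], the difference is four times the sum of the
     squares of [s], [u], [v], [t] minus the square of their sum. *)
  pose u := (xP + xQ) / 2 - xB; pose v := xC - (xP + xQ) / 2.
  pose s := xB - x0; pose t := x1 - xC.
  have -> : E - 2 * (xP - xQ) ^+ 2 =
      (s - u) ^+ 2 + (s - v) ^+ 2 + (s - t) ^+ 2 + (u - v) ^+ 2 +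
      (u - t) ^+ 2 + (v - t) ^+ 2.
    by rewrite /E /u /v /s /t; field.
  by rewrite !addr_ge0 ?sqr_ge0.
have dl0 : 0 < d * l by rewrite mulr_gt0.
have c0 : 0 < (2 * d * l)^-1 by rewrite invr_gt0 -mulrA mulr_gt0.
apply: (@le_trans _ _ (d * l + (2 * d * l)^-1 * (2 * (xP - xQ) ^+ 2))); last first.
  by rewrite lerD2l ler_pM2l.
rewrite -[(xP - xQ) ^+ 2]real_normK ?num_real//; set x := `|_|.
rewrite -subr_ge0.
have -> : d * l + (2 * d * l)^-1 * (2 * x ^+ 2) - 2 * x =
    (d * l - x) ^+ 2 / (d * l).
  by field; rewrite !gt_eqF.
by rewrite divr_ge0 ?sqr_ge0// ltW.
Qed.

(** The subtracted energy of [e] closes the induction: the energies of the sub-edges cancel against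
    those in [rhombus_energy], and each level costs only [d * 4 ^- i] per word. At depth 0 the
    energy is at most [4 ^- i], whence the term [4 ^- i / (2 * d)]. *)
Lemma total_lip_le (d : R) K i (e : edge (laakso_graph i)) : 0 < d ->
  total_var q K e <= 4 ^+ K * ((1 + K%:R * d) * 4 ^- i + 4 ^- i / (2 * d) -
    (2 * d * 4 ^- i)^-1 * (f (edge_tgt e) - f (edge_src e)) ^+ 2).
Proof.
move=> d0; elim: K i e => [|K IH] i e.
  rewrite total_var0 expr0 mul1r mul0r addr0 mul1r.
  have := mdist_edge e; have := f_lip (edge_src e) (edge_tgt e).
  rewrite /q distrC -[(f _ - _) ^+ 2]real_normK ?num_real//.
  set x := `|_|; set l := 4 ^- i => h1 h2.
  have l0 : 0 < l by exact: exprV4_gt0.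
  have xl : x <= l by exact: le_trans h1 h2.
  have -> : l / (2 * d) = (2 * d * l)^-1 * l ^+ 2 by field; rewrite !gt_eqF.
  have c0 : 0 <= (2 * d * l)^-1 by rewrite invr_ge0 !mulr_ge0// ltW.
  have x2 : x ^+ 2 <= l ^+ 2 by rewrite ler_sqr ?nnegrE// ?normr_ge0// ltW.
  by have := ler_wpM2l c0 x2; lra.
rewrite (total_varS q_sym).
have ik k := IH _ (sub_edge e k).
have {ik} := (ik e0B, ik eBP, ik eBQ, ik ePC, ik eQC, ik eC1).
rewrite !edge_src_sub !edge_tgt_sub exprV4S (exprS _ K) -(natr1 K).
set x0 := f (edge_src e); set x1 := f (edge_tgt e).
set xB := f (inner_pt e B); set xP := f (inner_pt e P).
set xQ := f (inner_pt e Q); set xC := f (inner_pt e C).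
have l0 := exprV4_gt0 R i; move: (4 ^- i) l0 => l l0.
have := rhombus_energy x0 xB xP xQ xC x1 d0 l0.
rewrite -/(q _ _).
have -> : (2 * d * (l / 4))^-1 = 4 * (2 * d * l)^-1.
  by field; rewrite !gt_eqF.
have -> : l / 4 / (2 * d) = l / (2 * d) / 4 by field; rewrite gt_eqF.
set c := (2 * d * l)^-1; set a := l / (2 * d).
have N0 : 0 <= (4 : R) ^+ K by rewrite exprn_ge0.
move=> /(ler_wpM2l N0); move: (4 ^+ K) => N {N0} hN [[[[[]]]]].
by move: (c) hN => {}c; lra.
Qed.

End Lipschitz.

(** [rcons] restores the end point that a walk omits. The next walk then begins with a jump back
    along the whole edge, which costs at most [4 ^- i]. *)
Definition loop K i (e : edge (laakso_graph i)) : seq L :=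
  flatten [seq rcons (walk ks e) (edge_tgt e) | ks <- words K].

Lemma chain_loop (q : L -> L -> R) K i (e : edge (laakso_graph i)) :
  chain q (loop K e) (edge_src e) =
    total_var q K e + 4 ^+ K * q (edge_tgt e) (edge_src e).
Proof.
rewrite /loop /total_var -natrX -size_words; elim: (words K) => [|ks ws IH] /=.
  by rewrite big_nil mul0r addr0.
rewrite chain_cat big_cons IH -cats1 chain_cat /= -natr1.
have -> : head (edge_src e)
    (flatten [seq rcons (walk ks e) (edge_tgt e) | ks <- ws]) = edge_src e.
  by case: ws {IH} => //= ks' ws; rewrite -cats1 -catA head_walk.
by rewrite /walk_var; lra.
Qed.

(** These edges all start at the vertex 0, which gives the loops of all scales a common base
    point. *)
Fixpoint first_edge i : edge (laakso_graph i) :=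
  if i is i'.+1 then sub_edge (first_edge i') e0B else tt.

Lemma edge_src_first i : edge_src (first_edge i) = @pt 0 false.
Proof. by elim: i => //= i IH; rewrite edge_src_sub. Qed.

Lemma head_loop y K i (e : edge (laakso_graph i)) s :
  head y (loop K e ++ s) = edge_src e.
Proof.
have : (0 < size (words K))%N by rewrite size_words expn_gt0.
rewrite /loop; case: (words K) => //= ks ws _.
by rewrite -cats1 -!catA head_walk.
Qed.

Lemma exists_loop (j : nat) : exists w : seq L,
  [/\ forall y s, head y (w ++ s) = @pt 0 false,
      1 <= chain mdist w (@pt 0 false) &
      forall f : L -> R, (forall x y, `|f x - f y| <= mdist x y) ->
        chain (fun x y => `|f x - f y|) w (@pt 0 false) <= 2 ^- j.+1].
Proof.
(* With this [i] the total weight [4 ^ K * 4 ^- i] equals [4 ^- (j + 3)], that is [n ^- 2]. The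
   length is then at least [K / n ^ 2 = 1]. The parameter [d] below is [1 / n], the inverse square
   root of [K]. *)
pose n := (2 ^ (j + 3))%N; pose K := (n ^ 2)%N; pose i := (K + (j + 3))%N.
pose e := first_edge i.
have n0 : 0 < n%:R :> R by rewrite ltr0n expn_gt0.
have n1 : 1 <= n%:R :> R by rewrite ler1n expn_gt0.
have KE : K%:R = n%:R ^+ 2 :> R by rewrite natrX.
have iE : 4 ^+ K * 4 ^- i = (n%:R ^+ 2)^-1 :> R.
  rewrite /i exprD invfM mulrA divff ?expf_neq0// mul1r.
  by rewrite -[n%:R ^+ 2]natrX -expnM mulnC expnM natrX.
exists (loop K e); split.
- by move=> y s; rewrite head_loop edge_src_first.
- rewrite -(edge_src_first i) chain_loop.
  apply: le_trans (_ : total_var mdist K e <= _); last first.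
    by rewrite lerDl mulr_ge0 ?exprn_ge0// mdist_ge0.
  apply: le_trans (total_mdist_ge K e).
  by rewrite mulrCA iE KE divff// expf_neq0// gt_eqF.
move=> f f_lip; rewrite -(edge_src_first i) chain_loop.
have d0 : 0 < n%:R^-1 :> R by rewrite invr_gt0.
have h1 := total_lip_le f_lip K e d0.
have h2 : 4 ^+ K * `|f (edge_tgt e) - f (edge_src e)| <= 4 ^+ K * 4 ^- i.
  rewrite ler_wpM2l ?exprn_ge0// (le_trans (f_lip _ _))// metric_sym.
  exact: mdist_edge.
have h3 : 0 <= 4 ^+ K * ((2 * n%:R^-1 * 4 ^- i)^-1 *
    (f (edge_tgt e) - f (edge_src e)) ^+ 2).
  by rewrite mulr_ge0 ?exprn_ge0 // mulr_ge0 ?sqr_ge0.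
have h4 : 4 ^+ K * ((1 + K%:R / n%:R) / 4 ^+ i + 4 ^- i / (2 / n%:R)) =
    (4 ^+ K * 4 ^- i) * (1 + K%:R / n%:R + n%:R / 2) :> R.
  by field; rewrite !gt_eqF// exprn_gt0.
have : 2 ^- j.+1 = 4 / n%:R :> R.
  by rewrite /n natrX exprD exprS; field; rewrite expf_neq0.
move: h1 h2 h3 h4; rewrite iE KE => h1 h2 h3 h4 ->.
(* The last summand pays for the [4 ^ K] returns to the start of the edge. *)
have h5 : (n%:R ^+ 2)^-1 * (1 + n%:R ^+ 2 / n%:R + n%:R / 2) + (n%:R ^+ 2)^-1 <=
    4 / n%:R :> R.
  rewrite -subr_ge0.
  have -> : 4 / n%:R - ((n%:R ^+ 2)^-1 * (1 + n%:R ^+ 2 / n%:R + n%:R / 2) +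
    (n%:R ^+ 2)^-1) = (5 * n%:R - 4) / 2 / n%:R ^+ 2 :> R.
    by field; rewrite gt_eqF.
  by rewrite !divr_ge0// ?sqr_ge0//; lra.
lra.
Qed.

End Walks.

(** * Concatenation of infinitely many loops with a common base point *)

Section ConcatLoops.
Context {R : realType} {T : Type} (o : T) (w : nat -> seq T).
Hypothesis w_neq0 : forall n, (0 < size (w n))%N.
Hypothesis head_w : forall n y s, head y (w n ++ s) = o.

Fixpoint concat J : seq T := if J is J'.+1 then concat J' ++ w J' else [::].

Definition concat_seq n : T := nth o (concat n.+1) n.

Lemma size_concat J : (J <= size (concat J))%N.
Proof.
by elim: J => //= J IH; rewrite size_cat -addn1 leq_add.
Qed.

(** The case [k = size (concat J)] is included: there the default value [o] of [nth] coincides with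
    the first entry of the next loop. Thus the closing step of the last loop is a step of the
    infinite sequence. *)
Lemma nth_concat J k : (k <= size (concat J))%N ->
  nth o (concat J) k = concat_seq k.
Proof.
have head_o n : nth o (w n) 0 = o by rewrite nth0 -[w n]cats0 head_w.
have ext J1 d : (k <= size (concat J1))%N ->
    nth o (concat (d + J1)) k = nth o (concat J1) k.
  move=> kJ1; elim: d => // d <-.
  have : (k <= size (concat (d + J1)))%N.
    elim: d => //= d /leq_trans; apply; rewrite size_cat; exact: leq_addr.
  rewrite addSn /= nth_cat leq_eqVlt => /predU1P[->|-> //].
  by rewrite ltnn subnn head_o nth_default.
move=> kJ; have [Jk|kJ'] := leqP J k.+1.
  by rewrite /concat_seq -(subnK Jk) ext.
rewrite -(subnK (ltnW kJ')) ext//.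
exact: leq_trans (leqnSn k) (size_concat k.+1).
Qed.

Lemma chain_concat (q : T -> T -> R) J :
  chain q (concat J) o = \sum_(0 <= j < J) chain q (w j) o.
Proof.
elim: J => [|J IH]; first by rewrite big_nil.
rewrite big_nat_recr//= chain_cat -IH.
by have := head_w J o [::]; rewrite cats0 => ->.
Qed.

Lemma sum_concat_seq (q : T -> T -> R) J N : (N <= size (concat J))%N ->
  \sum_(0 <= k < N) q (concat_seq k) (concat_seq k.+1) =
  \sum_(0 <= k < N) q (nth o (concat J) k) (nth o (concat J) k.+1).
Proof.
move=> NJ; rewrite !big_nat; apply: eq_bigr => k kN.
by rewrite !nth_concat//; lia.
Qed.

(** Each loop has at least one entry, so the first [N] steps are among those of the first [N]
    loops. *)
Lemma concat_seq_le (q : T -> T -> R) (B : R) : (forall x y, 0 <= q x y) ->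
  (forall J, \sum_(0 <= j < J) chain q (w j) o <= B) ->
  forall N, \sum_(0 <= k < N) q (concat_seq k) (concat_seq k.+1) <= B.
Proof.
move=> q0 hB N; have NJ := size_concat N.
rewrite (sum_concat_seq q NJ) (le_trans _ (hB N))// -chain_concat chain_sum.
by rewrite [leRHS](@big_cat_nat _ _ _ N)//= lerDl sumr_ge0.
Qed.

Lemma concat_seq_unbounded (q : T -> T -> R) :
  (forall j, 1 <= chain q (w j) o) ->
  forall M, exists N, M <= \sum_(0 <= k < N) q (concat_seq k) (concat_seq k.+1).
Proof.
move=> q1 M; pose J := (Num.truncn M).+1; exists (size (concat J)).
rewrite (sum_concat_seq q (leqnn _)) -chain_sum chain_concat.
apply: le_trans (_ : J%:R <= _); first exact/ltW/truncnS_gt.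
rewrite -[J in J%:R]subn0 -sumr_const_nat.
by apply: ler_sum => j _; exact: q1.
Qed.

End ConcatLoops.

(** * Running through a sequence in finite time *)

Section StepPath.
Context {R : realType} (a b : R) (hab : a < b).

(** The increments of the control function [F] telescope along every partition. *)
Lemma total_variation_control (f F : R -> R) :
  (forall x y, a <= x -> x <= y -> y <= b -> `|f y - f x| <= F y - F x) ->
  (total_variation a b f <= (F b - F a)%:E)%E.
Proof.
move=> fF; apply: ge_ereal_sup => _ [_ [s [ps /eqP lsb] <-] <-]; rewrite lee_fin.
suff H x : a <= x -> path <%R x s -> last x s = b ->
    variation x b f s <= F b - F x by exact: H.
elim: s x {ps lsb} => [|y s IH] x ax /=.
  by move=> _ ->; rewrite variation_nil subrr.
case/andP => xy ps lsb.
have yb : y <= b.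
  have /(order_path_min lt_trans)/allP := ps.
  by case: s {IH ps} lsb => [<-//|z s] <- /(_ _ (mem_last z s))/ltW.
have ay : a <= y by rewrite (le_trans ax)// ltW.
have := IH y ay ps lsb; have := fF x y ax (ltW xy) yb.
rewrite /variation /= big_nat_recl//=; lra.
Qed.

Context {T : metricType R} (u : nat -> T).

(** The quotient maps [[a, b[] increasingly onto [[0, +oo[], so all of the sequence is traversed
    before time [b]. *)
Definition step_index (t : R) : nat := Num.truncn ((t - a) / (b - t)).

Definition step_path (t : R) : T := if t < b then u (step_index t) else u 0%N.

Lemma step_index_le x y : a <= x -> x <= y -> y < b ->
  (step_index x <= step_index y)%N.
Proof.
move=> ax xy yb; apply: le_truncn.
have [bx by'] : 0 < b - x /\ 0 < b - y by split; lra.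
by apply: ler_pM; rewrite ?invr_ge0 ?lef_pV2 ?posrE//; lra.
Qed.

(** The solution [t] of [(t - a) / (b - t) = k]. *)
Definition step_time (k : nat) : R := b - (b - a) / k.+1%:R.

Lemma step_time_lt k : step_time k < b.
Proof. by rewrite /step_time gtrDl oppr_lt0 divr_gt0// subr_gt0. Qed.

Lemma step_time0 : step_time 0 = a.
Proof. by rewrite /step_time divr1 subKr. Qed.

Lemma step_timeS k : step_time k < step_time k.+1.
Proof.
rewrite /step_time ltrD2l ltrN2 ltr_pM2l ?subr_gt0//.
by rewrite ltf_pV2 ?posrE// ltr_nat.
Qed.

Lemma step_path_time k : step_path (step_time k) = u k.
Proof.
rewrite /step_path step_time_lt; congr u.
rewrite /step_index /step_time.
have -> : (b - (b - a) / k.+1%:R - a) / (b - (b - (b - a) / k.+1%:R)) = k%:R.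
  rewrite -(natr1 k); field; have : 0 <= k%:R :> R by [].
  move=> k0; have -> : b * (k%:R + 1) - (b * (k%:R + 1) - (b - a)) = b - a by ring.
  by rewrite !gt_eqF ?subr_gt0 //; lra.
exact: natrK.
Qed.

Lemma step_path_variation_le (f : T -> R) (B : R) :
  (forall N, \sum_(0 <= k < N) `|f (u k) - f (u k.+1)| <= B) ->
  (total_variation a b (f \o step_path) <= (2 * B)%:E)%E.
Proof.
move=> hB; pose Phi N := \sum_(0 <= k < N) `|f (u k) - f (u k.+1)|.
have Phi_le m n : (m <= n)%N -> `|f (u n) - f (u m)| <= Phi n - Phi m.
  move=> mn; have -> : Phi n = Phi m + \sum_(m <= k < n) `|f (u k) - f (u k.+1)|.
    by rewrite /Phi -big_cat_nat.
  rewrite addrAC subrr add0r.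
  rewrite -(@telescope_sumr _ m n (fun k => f (u k)))//.
  apply: le_trans (ler_norm_sum _ _ _) _.
  by apply: ler_sum => k _; rewrite distrC.
have Phi0 : Phi 0%N = 0 by rewrite /Phi big_nil.
(* [Phi] stays below [B] before time [b], so the jump of [F] at [b] is at least [B]; this covers the
   return of the path to [u 0]. *)
pose F t := if t < b then Phi (step_index t) else 2 * B.
have Fa : F a = 0.
  by rewrite /F hab /step_index subrr mul0r truncn0.
have Fb : F b = 2 * B by rewrite /F ltxx.
have := @total_variation_control (f \o step_path) F.
rewrite Fa Fb subr0; apply => x y ax xy yb.
rewrite /F /step_path /=; case: (ltP y b) => [yb'|by'].
  by rewrite (le_lt_trans xy yb') Phi_le// step_index_le.
case: (ltP x b) => [xb|bx]; last by rewrite !subrr normr0.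
rewrite distrC; apply: le_trans (Phi_le 0%N _ _) _ => //; rewrite Phi0 subr0.
have := hB (step_index x); rewrite -/(Phi _); lra.
Qed.

Lemma step_path_variation_infty :
  (forall M, exists N, M <= \sum_(0 <= k < N) mdist (u k) (u k.+1)) ->
  metric_variation a b step_path = +oo%E.
Proof.
move=> hu; apply/eqyP => M M0; have [N hN] := hu M.
apply: le_trans (_ : (\sum_(0 <= k < N) mdist (u k) (u k.+1))%:E <= _)%E.
  by rewrite lee_fin.
(* The partition [step_time 0 = a], ..., [step_time N], [b]; the term of its last interval is
   bounded below by 0. *)
pose s := rcons (mkseq (fun k => step_time k.+1) N) b.
have size_s : size s = N.+1 by rewrite size_rcons size_mkseq.
have nth_s k : (k <= N)%N -> nth b (a :: s) k = step_time k.
  case: k => [_|k kN]; first by rewrite /= step_time0.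
  by rewrite /= nth_rcons size_mkseq kN nth_mkseq.
have nth_sN : nth b s N = b by rewrite nth_rcons size_mkseq ltnn eqxx.
have ps : itv_partition a b s.
  split; last by rewrite last_rcons.
  apply/(pathP b) => k; rewrite size_s ltnS => kN.
  rewrite nth_s//; move: kN; rewrite leq_eqVlt => /predU1P[->|kN].
    by rewrite nth_sN step_time_lt.
  by have := nth_s k.+1 kN; rewrite /= => ->; exact: step_timeS.
apply: le_ereal_sup_tmp; eexists; first by exists s.
rewrite lee_fin size_s big_nat_recr//= -[leLHS]addr0 lerD ?mdist_ge0//.
rewrite !big_nat; apply: ler_sum => k kN.
by have := nth_s k.+1; rewrite /= => ->//; rewrite nth_s ?(ltnW kN)// !step_path_time.
Qed.

End StepPath.

(** * The Laakso space is not in the class *)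

Lemma lip_const_le1 (R : realType) (T : metricType R) (f : T -> R) :
  (lip_const f <= 1)%E -> forall x y, `|f x - f y| <= mdist x y.
Proof.
move=> f1 x y; have [->|/eqP xy] := eqVneq x y.
  by rewrite subrr normr0 mdistxx.
have : ((`|f x - f y| / mdist x y)%:E <= 1)%E.
  by apply: le_trans f1; apply: ereal_sup_ubound; exists (x, y).
by rewrite lee_fin ler_pdivrMr ?mul1r// mdist_gt0; exact/eqP.
Qed.

(** The image of loop [j] has length at most [2 ^- j.+1], so all images together have length at most
    1, which the return at time [b] can at most double. The loops themselves have length at least 1
    each. *)
Lemma not_LCJ_completion (R : realType) (a b : R) (L : metricType R) : a < b ->
  is_union_completion (@laakso_incl R) L -> ~ LCJ a b L.
Proof.
move=> ab [_ [h [h_iso h_incl _]]] lcj.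
have /choice[w wP] := exists_loop h_iso h_incl.
set o := @pt R L h 0 false in wP.
have w_head j y s : head y (w j ++ s) = o by have [->] := wP j.
have w_ge1 j : 1 <= chain mdist (w j) o by have [] := wP j.
have w_neq0 j : (0 < size (w j))%N.
  by have := w_ge1 j; case: (w j) => //=; rewrite ler10.
pose u := concat_seq o w.
have := lcj (step_path a b u).
rewrite step_path_variation_infty//; last exact: concat_seq_unbounded.
suff: (lip_variation a b (step_path a b u) <= (2 * 1)%:E)%E.
  by move=> /le_lt_trans h2 /(_ (h2 _ (ltry _))); rewrite ltxx.
apply: ge_ereal_sup => _ [f /lip_const_le1 f_lip <-].
apply: step_path_variation_le => // N.
apply: (concat_seq_le w_neq0 w_head (q := fun x y => `|f x - f y|)) => // J.
apply: le_trans (_ : \sum_(0 <= j < J) 2 ^- j.+1 <= 1).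
  by apply: ler_sum => j _; have [_ _] := wP j; exact.
suff -> : \sum_(0 <= j < J) 2 ^- j.+1 = 1 - 2 ^- J :> R.
  by rewrite gerBl invr_ge0 exprn_ge0.
elim: J => [|J IH]; first by rewrite big_nil expr0 invr1 subrr.
by rewrite big_nat_recr//= IH exprS; field; rewrite expf_neq0.
Qed.

Theorem theorem1p6 (R : realType) (a b : R) (hab : a < b) :
  exists L : metricType R,
    [/\ is_gh_limit (laakso_X R) L,
        is_union_completion (@laakso_incl R) L &
        ~ LCJ a b L].
Proof.
have [L [ghL compL]] := laakso_space_exists R.
by exists L; split => //; exact: not_LCJ_completion.
Qed.
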